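(* Let $\sigma$ be an algebraic signature and $\mathcal{A} = (A,\sigma)$ a $\sigma$-structure with underlying set $A$. Let $(e_n)_{n \in \mathbb{N}}$ be a sequence of elements of $A$. Suppose there exists an endomorphism $f \in \mathrm{End}_\sigma(A)$ such that $f(e_n) = e_{n+1}$ for all $n \in \mathbb{N}$. If there exists $m \in \mathbb{N}$ such that $e_m \in \mathrm{Terms}^{\mathcal{A}}[e_0,\dots,e_{m-1}]$, then there exists $m \in \mathbb{N}$ such that for all $n \in \mathbb{N}$, $e_{m+n} \in \mathrm{Terms}^{\mathcal{A}}[e_0,\dots,e_{m-1}]$.
   Context: $\mathbb{N} = \{0,1,2,\dots\}$. An algebraic signature is a (single-sorted) signature consisting only of function symbols of finite arity (constants being function symbols of arity $0$), with no relation symbols. $\mathrm{End}_\sigma(A)$ is the set of $\sigma$-homomorphisms from $\mathcal{A}$ to itself. For $X \subseteq A$, $\mathrm{Terms}^{\mathcal{A}}[X]$ denotes the set of all elements of $A$ obtained by interpreting in $\mathcal{A}$ the $\sigma$-terms with variables taken from $X$ (i.e. the values in $\mathcal{A}$ of $\sigma$-terms when their variables are assigned elements of $X$). $\mathrm{Terms}^{\mathcal{A}}[e_0,\dots,e_{m-1}]$ means $\mathrm{Terms}^{\mathcal{A}}[\{e_0,\dots,e_{m-1}\}]$, where for $m=0$ the set $\{e_0,\dots,e_{m-1}\}$ is empty. *)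

(* Defs.v *)
From mathcomp Require Import all_boot.

Set Implicit Arguments.
Unset Strict Implicit.
Unset Printing Implicit Defensive.

Record signature := Signature {
  symbol :> Type;
  arity : symbol -> nat
}.

Record structure (sigma : signature) := Structure {
  carrier :> Type;
  interp : forall s : sigma, {ffun 'I_(arity s) -> carrier} -> carrier
}.

Definition is_hom (sigma : signature) (A B : structure sigma) (f : A -> B) :
    Prop :=
  forall (s : sigma) (args : {ffun 'I_(arity s) -> A}),
    f (interp args) = interp [ffun i => f (args i)].

Definition endomorphism (sigma : signature) (A : structure sigma) : Type :=
  {f : A -> A | is_hom f}.

Definition endo_fun (sigma : signature) (A : structure sigma) (f : endomorphism A) :
  A -> A := sval f.
Coercion endo_fun : endomorphism >-> Funclass.

Inductive term (sigma : signature) (V : Type) : Type :=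
  | Var of V
  | App (s : sigma) of {ffun 'I_(arity s) -> term sigma V}.

Fixpoint eval (sigma : signature) (A : structure sigma) (V : Type)
    (v : V -> A) (t : term sigma V) : A :=
  match t with
  | Var x => v x
  | App s args => interp [ffun i => eval v (args i)]
  end.

(* The variables of the terms are the elements of X themselves, each evaluated
   to itself, so that for empty X only the closed terms remain. *)
Definition Terms (sigma : signature) (A : structure sigma) (X : A -> Prop) :
    A -> Prop :=
  fun a => exists t : term sigma {x : A | X x}, eval sval t = a.

Definition initial_segment (T : Type) (e : nat -> T) (m : nat) : T -> Prop :=
  fun x => exists2 i, i < m & e i = x.

(* Main.v *)
Require Import Defs.
From mathcomp Require Import all_boot.

(** If [f (e n) = e n.+1] and [e m] lies in the subalgebra generated by
    [e 0, ..., e m.-1], then [f] maps each of these generators into that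
    subalgebra, hence maps the whole subalgebra into itself; so the subalgebra
    contains all the iterates [e (m + n)] of [e m]. *)

Section GeneratedSubalgebra.

Variables (sigma : signature) (A : structure sigma).
Implicit Types X Y : A -> Prop.

(* The induction principle generated for [term] has no hypothesis for the
   arguments nested in the [finfun]. *)
Lemma nested_term_ind (V : Type) (P : term sigma V -> Prop) :
    (forall x, P (Var sigma x)) ->
    (forall s (args : {ffun 'I_(arity s) -> term sigma V}),
       (forall i, P (args i)) -> P (App args)) ->
  forall t, P t.
Proof.
move=> PVar PApp; fix IH 1; case=> [x | s args]; first exact: PVar.
by apply: PApp => i; apply: IH.
Qed.

Lemma Terms_gen X x : X x -> Terms X x.
Proof. by move=> Xx; exists (Var sigma (exist _ x Xx)). Qed.

(** Arities are finite, so one term per argument can be chosen simultaneously without any choice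
    axiom. *)
Lemma Terms_interp X (s : sigma) (args : {ffun 'I_(arity s) -> A}) :
  (forall i, Terms X (args i)) -> Terms X (interp args).
Proof.
move=> /fin_all_exists[t tE]; exists (App [ffun i => t i]) => /=.
by congr interp; apply/ffunP => i; rewrite !ffunE.
Qed.

(** By induction on the term: a homomorphism moves past each operation, so only the images of the
    generators matter. *)
Lemma hom_Terms X Y (f : A -> A) : is_hom f ->
    (forall x, X x -> Terms Y (f x)) ->
  forall a, Terms X a -> Terms Y (f a).
Proof.
move=> f_hom fXY _ [t <-]; elim/nested_term_ind: t => [[x Xx] | s args IH] /=.
  exact: fXY.
by rewrite f_hom; apply: Terms_interp => i; rewrite !ffunE.
Qed.

End GeneratedSubalgebra.

Theorem proposition4p1 (sigma : signature) (A : structure sigma)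
    (e : nat -> A)
    (hf : exists f : endomorphism A, forall n : nat, f (e n) = e n.+1) :
  (exists m : nat, Terms (initial_segment e m) (e m)) ->
  exists m : nat, forall n : nat, Terms (initial_segment e m) (e (m + n)).
Proof.
case: hf => f fe [m Tm]; exists m; elim=> [|n IHn]; first by rewrite addn0.
rewrite addnS -fe; apply: hom_Terms IHn; first exact: svalP f.
move=> _ [i lt_im <-]; rewrite -/(endo_fun f _) fe.
have [lt_i1m | le_mi1] := ltnP i.+1 m; first by apply: Terms_gen; exists i.+1.
(* Here [i] is the last index below [m], so the image of [e i] is [e m], which lies in the
   subalgebra by [Tm]. *)
by have -> : i.+1 = m by apply/eqP; rewrite eqn_leq lt_im.
Qed.
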